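(* Let $\mathcal{X}$ and $\mathcal{C}$ be right closed monoidal categories. Let there be a strong action of $\mathcal{X}$ on $\mathcal{C}$ such that, for each object $X$ of $\mathcal{X}$, the strong monoidal endofunctor $(-)^X \colon \mathcal{C} \to \mathcal{C}$ has a right adjoint, denoted $(-)_X$. Then the semidirect product $\mathcal{X} \ltimes \mathcal{C}$ is a right closed monoidal category, with internal hom defined by \[ [\langle Y, B \rangle, \langle Z, C \rangle] = \langle [Y, Z], [B, C]_Y \rangle, \] where $[Y,Z]$ and $[B,C]$ are the internal homs of $\mathcal{X}$ and $\mathcal{C}$ respectively.
   Context: In a monoidal category the structure isomorphisms are directed as $\alpha_{A,B,C} \colon A \otimes (B \otimes C) \to (A \otimes B) \otimes C$, $\lambda_A \colon A \to \mathcal{I} \otimes A$, $\rho_A \colon A \otimes \mathcal{I} \to A$. An object's name also denotes its identity morphism. A monoidal category $\mathcal{M}$ is right closed if, for every object $B$, tensoring on the right $(-) \otimes B$ has a right adjoint, denoted $[B,-]$ (the internal hom), so that there are natural isomorphisms $\mathcal{M}(A \otimes B, C) \cong \mathcal{M}(A, [B,C])$. Strong action of $\mathcal{X}$ on $\mathcal{C}$: a strong monoidal functor $\Gamma$ from $\mathcal{X}$ to $[\mathcal{C},\mathcal{C}]$, the strict monoidal category of strong monoidal endofunctors of $\mathcal{C}$ and monoidal natural transformations, with tensor product given by functor composition in diagrammatic order. For an object $X$ (morphism $f$) of $\mathcal{X}$, write $(-)^X$ (respectively $(-)^f$) for $\Gamma(X)$ (respectively $\Gamma(f)$). The structure isomorphisms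 of the strong monoidal functor $(-)^X$ are $\varphi^X_{B,C} \colon B^X \otimes C^X \to (B \otimes C)^X$ and $\varphi^X \colon \mathcal{I}_{\mathcal{C}} \to \mathcal{I}_{\mathcal{C}}^X$. The structure isomorphisms of $\Gamma$, in the oplax direction, are monoidal natural isomorphisms with components $\psi^{X,Y}_C \colon C^{X \otimes Y} \to (C^X)^Y$ and $\psi_C \colon C^{\mathcal{I}_{\mathcal{X}}} \to C$. Semidirect product $\mathcal{X} \ltimes \mathcal{C}$ (a monoidal category): the underlying category is $\mathcal{X} \times \mathcal{C}$, with objects written $\langle X, C \rangle$. The tensor product is $\langle X, B \rangle \otimes \langle Y, C \rangle = \langle X \otimes Y, B^Y \otimes C \rangle$ (and correspondingly on morphisms) and the unit is $\langle \mathcal{I}_{\mathcal{X}}, \mathcal{I}_{\mathcal{C}} \rangle$. The structure maps are given by their components in $\mathcal{X}$ and in $\mathcal{C}$. Their $\mathcal{X}$-components are the structure maps $\alpha_{X,Y,Z}$, $\lambda_X$, $\rho_X$ of $\mathcal{X}$. Their $\mathcal{C}$-components are: for $\alpha_{\langle X,A \rangle, \langle Y,B \rangle, \langle Z,C \rangle}$, the composite $(\varphi^Z_{A^Y,B} \otimes C) \circ \alpha_{(A^Y)^Z,B^Z,C} \circ (\psi^{Y,Z}_A \otimes (B^Z \otimes C)) \colon A^{Y \otimes Z} \otimes (B^Z \otimes C) \to (A^Y \otimes B)^Z \otimes C$; for $\lambda_{\langle X,C \rangle}$, the composite $(\varphi^X \otimes C) \circ \lambda_C \colon C \to \mathcal{I}_{\mathcal{C}}^X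 \otimes C$; for $\rho_{\langle X,C \rangle}$, the composite $\rho_C \circ (\psi_C \otimes \mathcal{I}_{\mathcal{C}}) \colon C^{\mathcal{I}_{\mathcal{X}}} \otimes \mathcal{I}_{\mathcal{C}} \to C$. *)

(* Defs.v *)
From Stdlib Require Import ssreflect FunctionalExtensionality ProofIrrelevance.

Set Implicit Arguments.
Unset Strict Implicit.
Unset Printing Implicit Defensive.

Declare Scope cat_scope.
Delimit Scope cat_scope with cat.
Local Open Scope cat_scope.

Reserved Notation "g ∘ f" (at level 40, left associativity).
Reserved Notation "A ⊗ B" (at level 35, right associativity).
Reserved Notation "f ⊠ g" (at level 35, right associativity).

Record Category := {
  Ob :> Type;
  Hom : Ob -> Ob -> Type;
  idm : forall A, Hom A A;
  comp : forall A B C, Hom B C -> Hom A B -> Hom A C;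
  comp_idl : forall A B (f : Hom A B), comp (idm B) f = f;
  comp_idr : forall A B (f : Hom A B), comp f (idm A) = f;
  comp_assoc : forall A B C D (h : Hom C D) (g : Hom B C) (f : Hom A B),
    comp (comp h g) f = comp h (comp g f)
}.
Arguments Hom {_} _ _.
Arguments idm {_} _.
Arguments comp {_ _ _ _} _ _.
Notation "g ∘ f" := (comp g f) : cat_scope.

Record Iso (K : Category) (A B : K) := {
  iso_fwd :> Hom A B;
  iso_bwd : Hom B A;
  iso_fwdK : iso_bwd ∘ iso_fwd = idm A;
  iso_bwdK : iso_fwd ∘ iso_bwd = idm B
}.
Arguments iso_fwd {_ _ _} _.
Arguments iso_bwd {_ _ _} _.

Record Functor (K L : Category) := {
  fob :> K -> L;
  fmap : forall A B, Hom A B -> Hom (fob A) (fob B);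
  fmap_id : forall A, fmap (idm A) = idm (fob A);
  fmap_comp : forall A B C (g : Hom B C) (f : Hom A B),
    fmap (g ∘ f) = fmap g ∘ fmap f
}.
Arguments fmap {_ _} _ {_ _} _.

Record Adjunction (K L : Category) (F : Functor K L) (G : Functor L K) := {
  adj_to : forall A B, Hom (F A) B -> Hom A (G B);
  adj_from : forall A B, Hom A (G B) -> Hom (F A) B;
  adj_toK : forall A B (h : Hom (F A) B), adj_from (adj_to h) = h;
  adj_fromK : forall A B (h : Hom A (G B)), adj_to (adj_from h) = h;
  adj_nat : forall A A' B B' (f : Hom A' A) (h : Hom (F A) B) (g : Hom B B'),
    adj_to (g ∘ (h ∘ fmap F f)) = fmap G g ∘ (adj_to h ∘ f)
}.

Record RightAdjoint (K L : Category) (F : Functor K L) := {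
  radj :> Functor L K;
  radj_adj : Adjunction F radj
}.

Definition id_functor (K : Category) : Functor K K :=
  @Build_Functor K K (fun A => A) (fun A B f => f)
    (fun A => eq_refl) (fun A B C g f => eq_refl).

Definition comp_functor (K L M : Category) (G : Functor L M) (F : Functor K L) :
  Functor K M.
Proof.
refine {| fob := fun A => G (F A); fmap := fun A B f => fmap G (fmap F f) |}.
- abstract (by move=> A; rewrite !fmap_id).
- abstract (by move=> A B C g f; rewrite !fmap_comp).
Defined.

Definition prod_cat (K L : Category) : Category.
Proof.
refine {|
  Ob := Ob K * Ob L;
  Hom := fun p q => (Hom (fst p) (fst q) * Hom (snd p) (snd q))%type;
  idm := fun p => (idm (fst p), idm (snd p));
  comp := fun p q r g f => (fst g ∘ fst f, snd g ∘ snd f) |}.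
- abstract (by move=> p q [f1 f2] /=; rewrite !comp_idl).
- abstract (by move=> p q [f1 f2] /=; rewrite !comp_idr).
- abstract (by move=> p q r s h g f /=; rewrite !comp_assoc).
Defined.

Lemma prod_hom_eq (K L : Category) (p q : prod_cat K L) (f g : Hom p q) :
  fst f = fst g -> snd f = snd g -> f = g.
Proof. by case: f g => [f1 f2] [g1 g2] /= -> ->. Qed.

Definition prod_functor (K K' L L' : Category)
    (F : Functor K L) (G : Functor K' L') :
  Functor (prod_cat K K') (prod_cat L L').
Proof.
refine (@Build_Functor (prod_cat K K') (prod_cat L L')
  (fun p => (F (fst p), G (snd p)))
  (fun p q f => (fmap F (fst f), fmap G (snd f))) _ _).
- abstract (by move=> p /=; rewrite !fmap_id).
- abstract (by move=> p q r g f /=; rewrite !fmap_comp).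
Defined.

Record MonoidalCategory := {
  mcat :> Category;
  unit : mcat;
  tensO : mcat -> mcat -> mcat
    where "A ⊗ B" := (tensO A B);
  tensH : forall A A' B B' : mcat,
    Hom A A' -> Hom B B' -> Hom (A ⊗ B) (A' ⊗ B')
    where "f ⊠ g" := (tensH f g);
  tens_id : forall A B : mcat, idm A ⊠ idm B = idm (A ⊗ B);
  tens_comp : forall (A A' A'' B B' B'' : mcat)
    (f' : Hom A' A'') (f : Hom A A') (g' : Hom B' B'') (g : Hom B B'),
    (f' ∘ f) ⊠ (g' ∘ g) = (f' ⊠ g') ∘ (f ⊠ g);
  alpha : forall A B C : mcat, Iso (A ⊗ (B ⊗ C)) ((A ⊗ B) ⊗ C);
  lambda : forall A : mcat, Iso A (unit ⊗ A);
  rho : forall A : mcat, Iso (A ⊗ unit) A;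
  alpha_nat : forall (A A' B B' C C' : mcat)
    (f : Hom A A') (g : Hom B B') (h : Hom C C'),
    ((f ⊠ g) ⊠ h) ∘ alpha A B C = alpha A' B' C' ∘ (f ⊠ (g ⊠ h));
  lambda_nat : forall (A B : mcat) (f : Hom A B),
    (idm unit ⊠ f) ∘ lambda A = lambda B ∘ f;
  rho_nat : forall (A B : mcat) (f : Hom A B),
    f ∘ rho A = rho B ∘ (f ⊠ idm unit);
  pentagon : forall A B C D : mcat,
    (alpha A B C ⊠ idm D) ∘ (alpha A (B ⊗ C) D ∘ (idm A ⊠ alpha B C D))
    = alpha (A ⊗ B) C D ∘ alpha A B (C ⊗ D);
  triangle : forall A B : mcat,
    (rho A ⊠ idm B) ∘ (alpha A unit B ∘ (idm A ⊠ lambda B)) = idm (A ⊗ B)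
}.
Arguments unit {_}.
Arguments tensO {_} _ _.
Arguments tensH {_ _ _ _ _} _ _.
Arguments alpha {_} _ _ _.
Arguments lambda {_} _.
Arguments rho {_} _.
Notation "A ⊗ B" := (tensO A B) : cat_scope.
Notation "f ⊠ g" := (tensH f g) : cat_scope.

Definition tensor_right (M : MonoidalCategory) (B : M) : Functor M M.
Proof.
refine (@Build_Functor M M (fun A => A ⊗ B) (fun A A' f => f ⊠ idm B) _ _).
- abstract (by move=> A; rewrite tens_id).
- abstract (by move=> A A' A'' g f; rewrite -tens_comp comp_idl).
Defined.

(* For [H : RightClosed M], [H B] is the internal hom functor [[B, -]]. *)
Definition RightClosed (M : MonoidalCategory) :=
  forall B : M, RightAdjoint (tensor_right B).

Record StrongMonoidalFunctor (M N : MonoidalCategory) := {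
  smf :> Functor M N;
  phi : forall A B : M, Iso (smf A ⊗ smf B) (smf (A ⊗ B));
  phi0 : Iso unit (smf unit);
  phi_nat : forall (A A' B B' : M) (f : Hom A A') (g : Hom B B'),
    fmap smf (f ⊠ g) ∘ phi A B = phi A' B' ∘ (fmap smf f ⊠ fmap smf g);
  phi_alpha : forall A B C : M,
    phi (A ⊗ B) C ∘ ((phi A B ⊠ idm (smf C)) ∘ alpha (smf A) (smf B) (smf C))
    = fmap smf (alpha A B C) ∘ (phi A (B ⊗ C) ∘ (idm (smf A) ⊠ phi B C));
  phi_lambda : forall A : M,
    phi unit A ∘ ((phi0 ⊠ idm (smf A)) ∘ lambda (smf A))
    = fmap smf (lambda A);
  phi_rho : forall A : M,
    fmap smf (rho A) ∘ (phi A unit ∘ (idm (smf A) ⊠ phi0)) = rho (smf A)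
}.
Arguments phi {_ _} _ _ _.
Arguments phi0 {_ _} _.

Record MonoidalTransformation (M N : MonoidalCategory)
    (F G : StrongMonoidalFunctor M N) := {
  mt :> forall A : M, Hom (F A) (G A);
  mt_nat : forall (A B : M) (f : Hom A B), fmap G f ∘ mt A = mt B ∘ fmap F f;
  mt_phi : forall A B : M,
    mt (A ⊗ B) ∘ phi F A B = phi G A B ∘ (mt A ⊠ mt B);
  mt_phi0 : mt unit ∘ phi0 F = phi0 G
}.

Lemma mt_ext (M N : MonoidalCategory) (F G : StrongMonoidalFunctor M N)
    (s t : MonoidalTransformation F G) : (forall A, s A = t A) -> s = t.
Proof.
case: s t => [s s1 s2 s3] [t t1 t2 t3] /= e.
have {}e : s = t by apply: functional_extensionality_dep.
by subst t; f_equal; apply: proof_irrelevance.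
Qed.

Definition iso_refl (K : Category) (A : K) : Iso A A :=
  {| iso_fwd := idm A; iso_bwd := idm A;
     iso_fwdK := comp_idl (idm A); iso_bwdK := comp_idl (idm A) |}.

Definition iso_sym (K : Category) (A B : K) (i : Iso A B) : Iso B A :=
  {| iso_fwd := iso_bwd i; iso_bwd := iso_fwd i;
     iso_fwdK := iso_bwdK i; iso_bwdK := iso_fwdK i |}.

Definition iso_comp (K : Category) (A B C : K) (j : Iso B C) (i : Iso A B) :
  Iso A C.
Proof.
refine {| iso_fwd := j ∘ i; iso_bwd := iso_bwd i ∘ iso_bwd j |}.
- abstract (by rewrite comp_assoc -(comp_assoc (iso_bwd j)) iso_fwdK comp_idl iso_fwdK).
- abstract (by rewrite comp_assoc -(comp_assoc i) iso_bwdK comp_idl iso_bwdK).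
Defined.

Definition iso_tens (M : MonoidalCategory) (A A' B B' : M)
    (i : Iso A A') (j : Iso B B') : Iso (A ⊗ B) (A' ⊗ B').
Proof.
refine {| iso_fwd := i ⊠ j; iso_bwd := iso_bwd i ⊠ iso_bwd j |}.
- abstract (by rewrite -tens_comp !iso_fwdK tens_id).
- abstract (by rewrite -tens_comp !iso_bwdK tens_id).
Defined.

Definition iso_fmap (K L : Category) (F : Functor K L) (A B : K)
    (i : Iso A B) : Iso (F A) (F B).
Proof.
refine {| iso_fwd := fmap F i; iso_bwd := fmap F (iso_bwd i) |}.
- abstract (by rewrite -fmap_comp iso_fwdK fmap_id).
- abstract (by rewrite -fmap_comp iso_bwdK fmap_id).
Defined.

Definition iso_pair (K L : Category) (p q : prod_cat K L)
    (i : Iso (fst p) (fst q)) (j : Iso (snd p) (snd q)) : Iso p q.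
Proof.
refine (@Build_Iso (prod_cat K L) p q
  (iso_fwd i, iso_fwd j) (iso_bwd i, iso_bwd j) _ _).
- abstract (by rewrite /= !iso_fwdK).
- abstract (by rewrite /= !iso_bwdK).
Defined.

Lemma tens_compl (M : MonoidalCategory) (A A' A'' B : M)
    (f' : Hom A' A'') (f : Hom A A') :
  (f' ∘ f) ⊠ idm B = (f' ⊠ idm B) ∘ (f ⊠ idm B).
Proof. by rewrite -tens_comp comp_idl. Qed.

Lemma tens_compr (M : MonoidalCategory) (A A' B B' B'' : M)
    (f : Hom A A') (g' : Hom B' B'') (g : Hom B B') :
  f ⊠ (g' ∘ g) = (idm A' ⊠ g') ∘ (f ⊠ g).
Proof. by rewrite -tens_comp comp_idl. Qed.

Lemma iso_fwdKA (K : Category) (A B Z : K) (i : Iso A B) (f : Hom Z A) :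
  iso_bwd i ∘ (i ∘ f) = f.
Proof. by rewrite -comp_assoc iso_fwdK comp_idl. Qed.

Lemma iso_bwdKA (K : Category) (A B Z : K) (i : Iso A B) (f : Hom Z B) :
  i ∘ (iso_bwd i ∘ f) = f.
Proof. by rewrite -comp_assoc iso_bwdK comp_idl. Qed.

Lemma iso_cancel (K : Category) (A B Z : K) (i : Iso A B) (f g : Hom Z A) :
  i ∘ f = i ∘ g -> f = g.
Proof. by move=> e; rewrite -(iso_fwdKA i f) e iso_fwdKA. Qed.

Section Endo.
Variable C : MonoidalCategory.
Implicit Types F G H : StrongMonoidalFunctor C C.

Definition smf_id : StrongMonoidalFunctor C C.
Proof.
refine (@Build_StrongMonoidalFunctor C C (id_functor C)
  (fun A B => iso_refl (A ⊗ B)) (iso_refl unit) _ _ _ _) => //=.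
- abstract (by move=> *; rewrite comp_idl comp_idr).
- abstract (by move=> *; rewrite !tens_id !comp_idl comp_idr).
- abstract (by move=> *; rewrite tens_id !comp_idl).
- abstract (by move=> *; rewrite tens_id !comp_idr).
Defined.

(* Composition in diagrammatic order: first [F], then [G]. *)
Definition smf_comp F G : StrongMonoidalFunctor C C.
Proof.
refine (@Build_StrongMonoidalFunctor C C (comp_functor G F)
  (fun A B => iso_comp (iso_fmap G (phi F A B)) (phi G (F A) (F B)))
  (iso_comp (iso_fmap G (phi0 F)) (phi0 G)) _ _ _ _) => /=.
- abstract (move=> A A' B B' f g;
    by rewrite -comp_assoc -fmap_comp phi_nat fmap_comp !comp_assoc phi_nat).
- abstract (move=> A B D;
    have e1 := phi_nat G (phi F A B) (idm (F D));
    have e2 := phi_nat G (idm (F A)) (phi F B D);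
    rewrite !fmap_id in e1 e2;
    rewrite -(comp_idl (idm (G (F D)))) tens_comp !comp_assoc;
    rewrite -(comp_assoc (phi G _ _)) -e1 !comp_assoc phi_alpha;
    rewrite -!comp_assoc -!fmap_comp !comp_assoc phi_alpha !fmap_comp !comp_assoc;
    rewrite -[in RHS](comp_idl (idm (G (F A)))) tens_comp;
    by rewrite -(comp_assoc (phi G _ (F _))) -e2 !comp_assoc).
- abstract (move=> A;
    have e1 := phi_nat G (phi0 F) (idm (F A)); rewrite fmap_id in e1;
    rewrite -(comp_idl (idm (G (F A)))) tens_comp !comp_assoc;
    rewrite -(comp_assoc (phi G _ _)) -e1 !comp_assoc phi_lambda;
    by rewrite -!fmap_comp phi_lambda).
- abstract (move=> A;
    have e1 := phi_nat G (idm (F A)) (phi0 F); rewrite fmap_id in e1;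
    rewrite -(comp_idl (idm (G (F A)))) tens_comp !comp_assoc;
    rewrite -(comp_assoc (phi G _ _)) -e1 !comp_assoc;
    by rewrite -phi_rho -(phi_rho F) !fmap_comp !comp_assoc).
Defined.

Definition mt_id F : MonoidalTransformation F F.
Proof.
refine (@Build_MonoidalTransformation C C F F (fun A => idm (F A)) _ _ _).
- abstract (by move=> *; rewrite comp_idl comp_idr).
- abstract (by move=> *; rewrite tens_id comp_idl comp_idr).
- abstract (by rewrite comp_idl).
Defined.

Definition mt_comp F G H (t : MonoidalTransformation G H)
    (s : MonoidalTransformation F G) : MonoidalTransformation F H.
Proof.
refine (@Build_MonoidalTransformation C C F H (fun A => t A ∘ s A) _ _ _).
- abstract (by move=> A B f; rewrite -comp_assoc mt_nat !comp_assoc mt_nat).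
- abstract (by move=> A B; rewrite comp_assoc mt_phi -comp_assoc mt_phi tens_comp comp_assoc).
- abstract (by rewrite comp_assoc !mt_phi0).
Defined.

Definition mt_hcomp F F' G G' (s : MonoidalTransformation F F')
    (t : MonoidalTransformation G G') :
  MonoidalTransformation (smf_comp F G) (smf_comp F' G').
Proof.
refine (@Build_MonoidalTransformation C C (smf_comp F G) (smf_comp F' G')
  (fun A => t (F' A) ∘ fmap G (s A)) _ _ _) => /=.
- abstract (by move=> A B f; rewrite -comp_assoc mt_nat !comp_assoc -!fmap_comp mt_nat).
- abstract (move=> A B;
    rewrite comp_assoc -(comp_assoc (fmap G _)) -fmap_comp mt_phi fmap_comp;
    rewrite !comp_assoc phi_nat -(comp_assoc (mt t _)) -mt_nat !comp_assoc;
    by rewrite -(comp_assoc (mt t _)) mt_phi tens_comp !comp_assoc).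
- abstract (rewrite comp_assoc -(comp_assoc (fmap G _)) -fmap_comp mt_phi0;
    by rewrite -comp_assoc -mt_nat comp_assoc mt_phi0).
Defined.

Definition endo_cat : Category.
Proof.
refine (@Build_Category (StrongMonoidalFunctor C C)
  (@MonoidalTransformation C C) mt_id mt_comp _ _ _).
- abstract (by move=> F G s; apply: mt_ext => A /=; rewrite comp_idl).
- abstract (by move=> F G s; apply: mt_ext => A /=; rewrite comp_idr).
- abstract (by move=> F G H K u t s; apply: mt_ext => A /=; rewrite comp_assoc).
Defined.

Definition iso_of_mt (F G : endo_cat) (i : Iso F G) (A : C) :
  Iso ((F : StrongMonoidalFunctor C C) A) ((G : StrongMonoidalFunctor C C) A).
Proof.
refine {| iso_fwd := mt (iso_fwd i) A; iso_bwd := mt (iso_bwd i) A |}.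
- abstract (by have /= -> := f_equal (fun s : MonoidalTransformation F F => s A) (iso_fwdK i)).
- abstract (by have /= -> := f_equal (fun s : MonoidalTransformation G G => s A) (iso_bwdK i)).
Defined.

(* Source and target agree as functors and have equal structure maps, as strict
   associativity of composition requires; the components are identities.  The
   same holds for the unit constraints. *)
Definition endo_alpha F G H :
  @Iso endo_cat (smf_comp F (smf_comp G H)) (smf_comp (smf_comp F G) H).
Proof.
unshelve refine (@Build_Iso endo_cat _ _
  (@Build_MonoidalTransformation C C (smf_comp F (smf_comp G H))
    (smf_comp (smf_comp F G) H) (fun A => idm (H (G (F A)))) _ _ _)
  (@Build_MonoidalTransformation C C (smf_comp (smf_comp F G) H)
    (smf_comp F (smf_comp G H)) (fun A => idm (H (G (F A)))) _ _ _) _ _) => /=.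
- abstract (by move=> *; rewrite comp_idl comp_idr).
- abstract (by move=> *; rewrite tens_id comp_idl comp_idr fmap_comp comp_assoc).
- abstract (by rewrite comp_idl fmap_comp comp_assoc).
- abstract (by move=> *; rewrite comp_idl comp_idr).
- abstract (by move=> *; rewrite tens_id comp_idl comp_idr fmap_comp comp_assoc).
- abstract (by rewrite comp_idl fmap_comp comp_assoc).
- abstract (by apply: mt_ext => A /=; rewrite comp_idl).
- abstract (by apply: mt_ext => A /=; rewrite comp_idl).
Defined.

Definition endo_lambda F : @Iso endo_cat F (smf_comp smf_id F).
Proof.
unshelve refine (@Build_Iso endo_cat _ _
  (@Build_MonoidalTransformation C C F (smf_comp smf_id F)
    (fun A => idm (F A)) _ _ _)
  (@Build_MonoidalTransformation C C (smf_comp smf_id F) F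
    (fun A => idm (F A)) _ _ _) _ _) => /=.
- abstract (by move=> *; rewrite comp_idl comp_idr).
- abstract (by move=> *; rewrite tens_id fmap_id !comp_idl comp_idr).
- abstract (by rewrite fmap_id !comp_idl).
- abstract (by move=> *; rewrite comp_idl comp_idr).
- abstract (by move=> *; rewrite tens_id fmap_id !comp_idl comp_idr).
- abstract (by rewrite fmap_id !comp_idl).
- abstract (by apply: mt_ext => A /=; rewrite comp_idl).
- abstract (by apply: mt_ext => A /=; rewrite comp_idl).
Defined.

Definition endo_rho F : @Iso endo_cat (smf_comp F smf_id) F.
Proof.
unshelve refine (@Build_Iso endo_cat _ _
  (@Build_MonoidalTransformation C C (smf_comp F smf_id) F
    (fun A => idm (F A)) _ _ _)
  (@Build_MonoidalTransformation C C F (smf_comp F smf_id)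
    (fun A => idm (F A)) _ _ _) _ _) => /=.
- abstract (by move=> *; rewrite comp_idl comp_idr).
- abstract (by move=> *; rewrite tens_id comp_idl !comp_idr).
- abstract (by rewrite comp_idl comp_idr).
- abstract (by move=> *; rewrite comp_idl comp_idr).
- abstract (by move=> *; rewrite tens_id comp_idl !comp_idr).
- abstract (by rewrite comp_idl comp_idr).
- abstract (by apply: mt_ext => A /=; rewrite comp_idl).
- abstract (by apply: mt_ext => A /=; rewrite comp_idl).
Defined.

Definition endo : MonoidalCategory.
Proof.
refine (@Build_MonoidalCategory endo_cat smf_id smf_comp
  (fun F F' G G' s t => mt_hcomp s t) _ _ endo_alpha endo_lambda endo_rho
  _ _ _ _ _).
- abstract (by move=> F G; apply: mt_ext => A /=; rewrite fmap_id comp_idl).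
- abstract (move=> F F' F'' G G' G'' s' s t' t; apply: mt_ext => A /=;
    rewrite fmap_comp !comp_assoc; congr (_ ∘ _);
    by rewrite -!comp_assoc mt_nat).
- abstract (move=> F F' G G' H H' s t u; apply: mt_ext => A /=;
    by rewrite comp_idl comp_idr fmap_comp comp_assoc).
- abstract (by move=> F G s; apply: mt_ext => A /=; rewrite fmap_id comp_idl !comp_idr).
- abstract (by move=> F G s; apply: mt_ext => A /=; rewrite !comp_idl comp_idr).
- abstract (by move=> F G H K; apply: mt_ext => A /=; rewrite !fmap_id !comp_idl).
- abstract (by move=> F G; apply: mt_ext => A /=; rewrite !fmap_id !comp_idl).
Defined.

End Endo.

Definition StrongAction (X C : MonoidalCategory) :=
  StrongMonoidalFunctor X (endo C).

Section Action.
Variables (X C : MonoidalCategory) (Gam : StrongAction X C).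

(* [act Y] is the endofunctor [(-)^Y]; [actf f B] is the component at [B] of
   the transformation [(-)^f]. *)
Definition act (Y : X) : StrongMonoidalFunctor C C := Gam Y.

Definition actf (Y Y' : X) (f : Hom Y Y') :
  MonoidalTransformation (act Y) (act Y') := fmap Gam f.

(* The structure maps of the action in the oplax direction are the inverses of
   those carried by the strong monoidal functor [Gam]. *)
Definition psi (Y Z : X) (A : C) : Iso (act (Y ⊗ Z) A) (act Z (act Y A)) :=
  iso_of_mt (iso_sym (phi Gam Y Z)) A.

Definition psi0 (A : C) : Iso (act unit A) A :=
  iso_of_mt (iso_sym (phi0 Gam)) A.

(* The morphism [g^f : B^Y -> B'^Y']. *)
Definition actH (B B' : C) (Y Y' : X) (g : Hom B B') (f : Hom Y Y') :
  Hom (act Y B) (act Y' B') := actf f B' ∘ fmap (act Y) g.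

Lemma actf_id (Y : X) (A : C) : actf (idm Y) A = idm (act Y A).
Proof. by rewrite /actf fmap_id. Qed.

Lemma actf_comp (Y Y' Y'' : X) (g : Hom Y' Y'') (f : Hom Y Y') (A : C) :
  actf (g ∘ f) A = actf g A ∘ actf f A.
Proof. by rewrite /actf fmap_comp. Qed.

Lemma actH_id (Y : X) (B : C) : actH (idm B) (idm Y) = idm (act Y B).
Proof. by rewrite /actH actf_id fmap_id comp_idl. Qed.

Lemma actH_idr (Y : X) (B B' : C) (g : Hom B B') :
  actH g (idm Y) = fmap (act Y) g.
Proof. by rewrite /actH actf_id comp_idl. Qed.

Lemma actH_idl (Y Y' : X) (B : C) (f : Hom Y Y') : actH (idm B) f = actf f B.
Proof. by rewrite /actH fmap_id comp_idr. Qed.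

Lemma actH_comp (B B' B'' : C) (Y Y' Y'' : X) (g' : Hom B' B'') (g : Hom B B')
    (f' : Hom Y' Y'') (f : Hom Y Y') :
  actH (g' ∘ g) (f' ∘ f) = actH g' f' ∘ actH g f.
Proof.
rewrite /actH actf_comp fmap_comp !comp_assoc; congr (_ ∘ _).
by rewrite -!comp_assoc mt_nat.
Qed.

Lemma psi_natl (Y Z : X) (A B : C) (f : Hom A B) :
  fmap (act Z) (fmap (act Y) f) ∘ psi Y Z A = psi Y Z B ∘ fmap (act (Y ⊗ Z)) f.
Proof. exact: (mt_nat (iso_bwd (phi Gam Y Z)) f). Qed.

Lemma psi_natr (Y Y' Z Z' : X) (f : Hom Y Y') (g : Hom Z Z') (A : C) :
  psi Y' Z' A ∘ actf (f ⊠ g) A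
  = actf g (act Y' A) ∘ (fmap (act Z) (actf f A) ∘ psi Y Z A).
Proof.
have /= e := f_equal (fun s : MonoidalTransformation _ _ => s A)
  (phi_nat Gam f g).
apply: (iso_cancel (i := iso_sym (psi Y' Z' A))) => /=.
have e1 := iso_bwdKA (iso_of_mt (phi Gam Y' Z') A) (actf (f ⊠ g) A).
rewrite {}e1 -!comp_assoc /actf.
rewrite -[mt (fmap Gam (f ⊠ g)) A]comp_idr.
rewrite -(iso_bwdK (iso_of_mt (phi Gam Y Z) A)) /=.
by rewrite -comp_assoc e !comp_assoc.
Qed.

Lemma psi_phi (Y Z : X) (A B : C) :
  psi Y Z (A ⊗ B) ∘ phi (act (Y ⊗ Z)) A B
  = fmap (act Z) (phi (act Y) A B)
    ∘ (phi (act Z) (act Y A) (act Y B) ∘ (psi Y Z A ⊠ psi Y Z B)).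
Proof.
have /= -> := mt_phi (iso_bwd (phi Gam Y Z)) A B.
by rewrite comp_assoc.
Qed.

Lemma psi0_nat (A B : C) (f : Hom A B) :
  f ∘ psi0 A = psi0 B ∘ fmap (act unit) f.
Proof. exact: (mt_nat (iso_bwd (phi0 Gam)) f). Qed.

Lemma psi_alpha (Y Z W : X) (A : C) :
  fmap (act W) (psi Y Z A) ∘ (psi (Y ⊗ Z) W A ∘ actf (alpha Y Z W) A)
  = psi Z W (act Y A) ∘ psi Y (Z ⊗ W) A.
Proof.
have /= e := f_equal (fun s : MonoidalTransformation _ _ => s A)
  (phi_alpha Gam Y Z W).
rewrite !fmap_id !comp_idr !comp_idl in e.
apply: (iso_cancel (i := iso_sym (iso_fmap (act W) (psi Y Z A)))).
rewrite iso_bwdKA.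
apply: (iso_cancel (i := iso_sym (psi (Y ⊗ Z) W A))).
rewrite iso_bwdKA /=.
rewrite -comp_assoc e !comp_assoc.
have e1 := iso_bwdKA (iso_of_mt (phi Gam Z W) (act Y A)).
have /= {}e1 := e1 _ (iso_bwd (iso_of_mt (phi Gam Y (Z ⊗ W)) A)).
rewrite [X in _ ∘ (_ ∘ X)]e1.
have /= -> := iso_bwdK (iso_of_mt (phi Gam Y (Z ⊗ W)) A).
by rewrite comp_idr.
Qed.

Lemma psi_lambda (Y : X) (A : C) :
  fmap (act Y) (psi0 A) ∘ (psi unit Y A ∘ actf (lambda Y) A) = idm (act Y A).
Proof.
have /= e := f_equal (fun s : MonoidalTransformation _ _ => s A)
  (phi_lambda Gam Y).
rewrite comp_idr comp_idl in e.
rewrite /actf -{}e.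
have /= -> := iso_fwdKA (iso_of_mt (phi Gam unit Y) A).
exact: (iso_bwdK (iso_fmap (act Y) (psi0 A))).
Qed.

Lemma actH_phi (A A' B B' : C) (Z Z' : X) (f : Hom A A') (g : Hom B B')
    (h : Hom Z Z') :
  actH (f ⊠ g) h ∘ phi (act Z) A B
  = phi (act Z') A' B' ∘ (actH f h ⊠ actH g h).
Proof.
rewrite /actH comp_assoc phi_nat -comp_assoc mt_phi comp_assoc.
by rewrite -tens_comp.
Qed.

Lemma actH_phi0 (Y Y' : X) (f : Hom Y Y') :
  actH (idm unit) f ∘ phi0 (act Y) = phi0 (act Y').
Proof. by rewrite /actH fmap_id comp_idr mt_phi0. Qed.

Lemma actH_psi (A A' : C) (Y Y' Z Z' : X) (f : Hom A A') (g : Hom Y Y')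
    (h : Hom Z Z') :
  actH (actH f g) h ∘ psi Y Z A = psi Y' Z' A' ∘ actH f (g ⊠ h).
Proof.
rewrite /actH fmap_comp -(comp_assoc (iso_fwd _)) psi_natr !comp_assoc.
by rewrite psi_natl.
Qed.

#[local] Opaque psi psi0.

Definition sd_tensO (p q : prod_cat X C) : prod_cat X C :=
  (fst p ⊗ fst q, act (fst q) (snd p) ⊗ snd q).

Definition sd_tensH (p p' q q' : prod_cat X C) (f : Hom p p') (g : Hom q q') :
  Hom (sd_tensO p q) (sd_tensO p' q') :=
  (fst f ⊠ fst g, actH (snd f) (fst g) ⊠ snd g).

Definition sd_unit : prod_cat X C := (unit, unit).

Definition sd_alpha (p q r : prod_cat X C) :
  Iso (sd_tensO p (sd_tensO q r)) (sd_tensO (sd_tensO p q) r) :=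
  @iso_pair X C (sd_tensO p (sd_tensO q r)) (sd_tensO (sd_tensO p q) r)
    (alpha (fst p) (fst q) (fst r))
    (iso_comp
      (iso_tens (phi (act (fst r)) (act (fst q) (snd p)) (snd q))
        (iso_refl (snd r)))
      (iso_comp
        (alpha (act (fst r) (act (fst q) (snd p))) (act (fst r) (snd q)) (snd r))
        (iso_tens (psi (fst q) (fst r) (snd p))
          (iso_refl (act (fst r) (snd q) ⊗ snd r))))).

Definition sd_lambda (p : prod_cat X C) : Iso p (sd_tensO sd_unit p) :=
  @iso_pair X C p (sd_tensO sd_unit p)
    (lambda (fst p))
    (iso_comp (iso_tens (phi0 (act (fst p))) (iso_refl (snd p)))
      (lambda (snd p))).

Definition sd_rho (p : prod_cat X C) : Iso (sd_tensO p sd_unit) p :=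
  @iso_pair X C (sd_tensO p sd_unit) p
    (rho (fst p))
    (iso_comp (rho (snd p)) (iso_tens (psi0 (snd p)) (iso_refl unit))).

Lemma sd_alpha_nat (p p' q q' r r' : prod_cat X C)
    (f : Hom p p') (g : Hom q q') (h : Hom r r') :
  sd_tensH (sd_tensH f g) h ∘ sd_alpha p q r
  = sd_alpha p' q' r' ∘ sd_tensH f (sd_tensH g h).
Proof.
apply: prod_hom_eq; first exact: alpha_nat.
move=> /=.
rewrite -comp_assoc -tens_comp actH_phi comp_idr.
rewrite -[snd h in LHS]comp_idl tens_comp.
rewrite !comp_assoc -(comp_assoc _ (alpha _ _ _)) alpha_nat.
by rewrite !comp_assoc -!tens_comp actH_psi comp_idl comp_idr.
Qed.

Lemma sd_lambda_nat (p q : prod_cat X C) (f : Hom p q) :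
  sd_tensH (idm sd_unit) f ∘ sd_lambda p = sd_lambda q ∘ f.
Proof.
apply: prod_hom_eq; first exact: lambda_nat.
move=> /=.
rewrite -comp_assoc -tens_comp actH_phi0 comp_idr.
by rewrite comp_assoc -lambda_nat -comp_assoc -tens_comp comp_idl comp_idr.
Qed.

Lemma sd_rho_nat (p q : prod_cat X C) (f : Hom p q) :
  f ∘ sd_rho p = sd_rho q ∘ sd_tensH f (idm sd_unit).
Proof.
apply: prod_hom_eq; first exact: rho_nat.
move=> /=.
rewrite -comp_assoc rho_nat !comp_assoc -!tens_comp !comp_idl.
by rewrite /actH actf_id comp_idl psi0_nat.
Qed.

Lemma sd_triangle (p q : prod_cat X C) :
  sd_tensH (sd_rho p) (idm q)
    ∘ (sd_alpha p sd_unit q ∘ sd_tensH (idm p) (sd_lambda q))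
  = idm (sd_tensO p q).
Proof.
case: p q => [U A] [V B].
apply: prod_hom_eq; first exact: triangle.
move=> /=.
rewrite actH_idr actH_idl !fmap_comp.
rewrite !comp_assoc -tens_comp comp_idl.
have e := phi_nat (act V) (psi0 A) (idm unit); rewrite fmap_id in e.
rewrite -(comp_assoc (_ ⊠ idm B)) -tens_comp comp_idl comp_assoc e.
rewrite -(comp_assoc (fmap _ (rho A))) tens_compl comp_assoc.
rewrite -(comp_assoc ((_ ⊠ _) ⊠ _)) alpha_nat.
rewrite !comp_assoc -tens_comp psi_lambda tens_id comp_idl.
rewrite tens_compr -(comp_assoc (alpha _ _ _)) -alpha_nat.
rewrite comp_assoc -(comp_assoc (_ ⊠ idm B)) -tens_compl comp_assoc phi_rho.
exact: triangle.
Qed.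

Lemma sd_pentagon (p q r s : prod_cat X C) :
  sd_tensH (sd_alpha p q r) (idm s)
    ∘ (sd_alpha p (sd_tensO q r) s ∘ sd_tensH (idm p) (sd_alpha q r s))
  = sd_alpha (sd_tensO p q) r s ∘ sd_alpha p q (sd_tensO r s).
Proof.
case: p q r s => [U A] [V B] [W D] [T E].
apply: prod_hom_eq; first exact: pentagon.
move=> /=.
rewrite actH_idr actH_idl !fmap_comp !tens_compl !comp_assoc.
have e1 := phi_nat (act T) (psi V W A) (idm (act W B ⊗ D)).
have e2 := phi_nat (act T) (phi (act W) (act V A) B) (idm D).
rewrite !fmap_id in e1 e2.
rewrite -(comp_assoc (fmap _ (_ ⊠ idm (_ ⊗ D)) ⊠ _)) -tens_compl e1.
rewrite tens_compl comp_assoc -(comp_assoc ((_ ⊠ _) ⊠ _)) alpha_nat.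
rewrite !comp_assoc -!tens_comp !comp_idl tens_id comp_idl psi_alpha.
rewrite -(comp_assoc (psi W T _ ⊠ _)) -tens_compl psi_phi !tens_compl !comp_assoc.
rewrite -(comp_assoc ((_ ⊠ _) ⊠ idm (_ ⊗ E))) alpha_nat.
rewrite comp_assoc -tens_comp comp_idr.
rewrite tens_compr -(comp_assoc (alpha _ _ E)) -alpha_nat.
rewrite !comp_assoc.
rewrite [in LHS]tens_compr.
rewrite -(comp_assoc (phi _ _ (_ ⊗ D) ⊠ idm E)) -tens_compl.
rewrite -(comp_assoc (fmap _ (alpha _ _ _) ⊠ _)) -tens_compl -phi_alpha.
rewrite !tens_compl !comp_assoc.
rewrite -(comp_assoc (fmap _ _ ⊠ idm E)) -tens_compl e2 tens_compl comp_assoc.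
rewrite -(comp_assoc (alpha _ (_ ⊗ _) E)) -(comp_assoc (alpha _ _ _ ⊠ _)).
rewrite pentagon !comp_assoc.
rewrite -(comp_assoc ((phi _ _ _ ⊠ _) ⊠ _)) alpha_nat comp_assoc.
rewrite -(comp_assoc ((fmap _ _ ⊠ _) ⊠ _)) alpha_nat comp_assoc.
by rewrite !tens_id.
Qed.

Lemma sd_tens_id (p q : prod_cat X C) :
  sd_tensH (idm p) (idm q) = idm (sd_tensO p q).
Proof. by apply: prod_hom_eq; rewrite /= ?actH_id tens_id. Qed.

Lemma sd_tens_comp (p p' p'' q q' q'' : prod_cat X C)
    (f' : Hom p' p'') (f : Hom p p') (g' : Hom q' q'') (g : Hom q q') :
  sd_tensH (f' ∘ f) (g' ∘ g) = sd_tensH f' g' ∘ sd_tensH f g.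
Proof. by apply: prod_hom_eq; rewrite /= ?actH_comp tens_comp. Qed.

Definition semidirect : MonoidalCategory := {|
  mcat := prod_cat X C;
  unit := sd_unit;
  tensO := sd_tensO;
  tensH := sd_tensH;
  tens_id := sd_tens_id;
  tens_comp := sd_tens_comp;
  alpha := sd_alpha;
  lambda := sd_lambda;
  rho := sd_rho;
  alpha_nat := sd_alpha_nat;
  lambda_nat := sd_lambda_nat;
  rho_nat := sd_rho_nat;
  pentagon := sd_pentagon;
  triangle := sd_triangle
|}.

End Action.

(* Main.v *)
From Stdlib Require Import ssreflect.
Require Import Defs.

Set Implicit Arguments.
Unset Strict Implicit.
Unset Printing Implicit Defensive.

Local Open Scope cat_scope.

(** Right tensoring with [(Y, B)] in the semidirect product acts as the product
    of the functors [(-) ⊗ Y] and [(-)^Y ⊗ B].  Each factor has a right adjoint,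
    the second being a composite of two left adjoints, and adjunctions are closed
    under composition and products. *)

Definition adj_compose (K L M : Category)
    (F : Functor K L) (G : Functor L K) (F' : Functor L M) (G' : Functor M L)
    (a : Adjunction F G) (a' : Adjunction F' G') :
  Adjunction (comp_functor F' F) (comp_functor G G').
Proof.
refine (@Build_Adjunction K M (comp_functor F' F) (comp_functor G G')
  (fun A B h => adj_to a (adj_to a' h))
  (fun A B h => adj_from a' (adj_from a h)) _ _ _).
- by move=> A B h; rewrite !adj_toK.
- by move=> A B h; rewrite !adj_fromK.
(* Naturality of [a'] leaves [fmap F f] as the inner factor, the shape to which naturality of [a]
   then applies. *)
- by move=> A A' B B' f h g /=; rewrite !adj_nat.
Defined.

Definition adj_prod (K L K' L' : Category)
    (F : Functor K L) (G : Functor L K) (F' : Functor K' L') (G' : Functor L' K')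
    (a : Adjunction F G) (a' : Adjunction F' G') :
  Adjunction (prod_functor F F') (prod_functor G G').
Proof.
refine (@Build_Adjunction _ _ (prod_functor F F') (prod_functor G G')
  (fun A B h => (adj_to a (fst h), adj_to a' (snd h)))
  (fun A B h => (adj_from a (fst h), adj_from a' (snd h))) _ _ _).
- by move=> A B [h1 h2] /=; rewrite !adj_toK.
- by move=> A B [h1 h2] /=; rewrite !adj_fromK.
- by move=> A A' B B' f h g /=; rewrite !adj_nat.
Defined.

Section SemidirectClosed.
Variables (X C : MonoidalCategory) (Gam : StrongAction X C).

Let tensor_prod (p : prod_cat X C) :=
  prod_functor (tensor_right (fst p))
    (comp_functor (tensor_right (snd p)) (act Gam (fst p))).

(* The two functors agree on objects by conversion, but on morphisms only up to
   the equation [actH_idr]. *)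
Lemma fmap_semidirect_tensor_right (p A A' : semidirect Gam) (f : Hom A A') :
  fmap (tensor_right p) f = fmap (tensor_prod p) f.
Proof. by apply: prod_hom_eq => //=; rewrite actH_idr. Qed.

(** Hom-sets of [semidirect Gam] are those of [prod_cat X C] by conversion, so the bijections of [a]
    are reused as they stand, with no transport along an equality of functors. *)
Definition semidirect_adj (p : prod_cat X C) (G : Functor (prod_cat X C) (prod_cat X C))
    (a : Adjunction (tensor_prod p) G) :
  @Adjunction (semidirect Gam) (semidirect Gam) (tensor_right (p : semidirect Gam)) G.
Proof.
refine (@Build_Adjunction (semidirect Gam) (semidirect Gam)
  (tensor_right (p : semidirect Gam)) G
  (fun A B h => adj_to a h) (fun A B h => adj_from a h) _ _ _).
- by move=> A B h; apply: (adj_toK a).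
- by move=> A B h; apply: (adj_fromK a).
(* Only naturality sees the tensor functor on morphisms. *)
- by move=> A A' B B' f h g; rewrite fmap_semidirect_tensor_right; apply: (adj_nat a).
Defined.

Definition semidirect_closed (HX : RightClosed X) (HC : RightClosed C)
    (R : forall Y : X, RightAdjoint (act Gam Y)) : RightClosed (semidirect Gam) :=
  fun p => Build_RightAdjoint (semidirect_adj
    (adj_prod (radj_adj (HX (fst p)))
      (adj_compose (radj_adj (R (fst p))) (radj_adj (HC (snd p)))))).

End SemidirectClosed.

Theorem theorem7p2
  (X C : MonoidalCategory)
  (HX : RightClosed X) (HC : RightClosed C)
  (Gam : StrongAction X C)
  (R : forall Y : X, RightAdjoint (act Gam Y)) :
  exists K : RightClosed (semidirect Gam),
    (forall (Y Z : X) (B C0 : C),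
       K (Y, B) (Z, C0) = (HX Y Z, R Y (HC B C0))) /\
    (forall (Y : X) (B : C),
       radj (K (Y, B))
       = prod_functor (HX Y) (comp_functor (R Y) (HC B))).
(* The witness is transparent: its [radj] unfolds to the product functor, so both equations hold by
   conversion. *)
Proof. by exists (semidirect_closed HX HC R). Qed.
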